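(* Let $G$ be a locally compact group endowed with a left Haar measure $\mu_G$ and a proper length function $\mathcal{L}$. Let $B$ be a compact space, $\nu$ a Borel probability measure on $B$, and consider a measurable action of $G$ on $B$ leaving $\nu$ quasi-invariant. Assume that - the Radon-Nikodym cocycle and the Harish-Chandra function $\Xi$ of the action are continuous; - the compact subgroup $G_0=\{g\in G:\mathcal{L}(g)=0\}$ is open, acts transitively on $B$ and leaves $\nu$ invariant. Let $\Lambda$ be a lattice in $G$, let $L$ be the restriction of $\mathcal{L}$ to $\Lambda$, and assume that there is $c\in\mathbb{R}$ such that for all sufficiently large $n$, $\mu_G(C^G_n)\le c\,|C^\Lambda_n|$, where $C^G_n=\{g\in G:\mathcal{L}(g)\in[n,n+1)\}$ and $C^\Lambda_n=\{\gamma\in\Lambda: L(\gamma)\in[n,n+1)\}$. Let $\pi$ be the Koopman representation of $\Lambda$ associated with the restricted action $\Lambda\curvearrowright B$. Then there is $M\in\mathbb{R}$ such that for all $n\in\mathbb{N}$ with $C_n^\Lambda\ne\emptyset$, $$\left\Vert\frac{1}{|C^\Lambda_n|}\sum_{\gamma\in C^\Lambda_n}\frac{\pi(\gamma)}{\Xi(\gamma)}\right\Vert_{2\to2}\le M.$$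
   Context: A length function on a group $G$ with identity $e$ is a map $\mathcal{L}:G\to\mathbb{R}_+$ with $\mathcal{L}(e)=0$, $\mathcal{L}(g^{-1})=\mathcal{L}(g)$, $\mathcal{L}(gh)\le\mathcal{L}(g)+\mathcal{L}(h)$; it is proper if $\{g:\mathcal{L}(g)\le t\}$ is compact for every $t\ge0$. $\nu$ is quasi-invariant if $\nu(C)=0$ implies $\nu(gC)=0$ for all $g\in G$ and measurable $C$. The Radon-Nikodym cocycle is $c:G\times B\to\mathbb{R}_+^*$, $c(g,b)=\frac{d(g^{-1})_*\nu}{d\nu}(b)$ (continuity means that these derivatives admit a version continuous on $G\times B$, which is the one used). The Koopman representation is $(\pi(g)h)(b)=c(g^{-1},b)^{1/2}h(g^{-1}b)$ on $L^2(B,\nu)$, and the Harish-Chandra function is $\Xi(g)=\int_Bc(g^{-1},b)^{1/2}\,d\nu(b)$. $\Vert\cdot\Vert_{2\to2}$ is the operator norm on $L^2(B,\nu)$. *)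

(* Defs.v *)
From HB Require Import structures.
From mathcomp Require Import all_boot all_order all_algebra.
From mathcomp Require Import finmap generic_quotient.
From mathcomp Require Import all_classical all_reals all_analysis.
From mathcomp Require Import complex.

Set Implicit Arguments.
Unset Strict Implicit.
Unset Printing Implicit Defensive.

Import Order.TTheory GRing.Theory Num.Theory.
Import numFieldNormedType.Exports.

Local Open Scope quotient_scope.
Local Open Scope classical_set_scope.
Local Open Scope ring_scope.

(* MathComp-Analysis only has additive topological groups. The distinguished
   point required by [PointedTopological] is irrelevant: it is there because
   measurable types are pointed. *)
HB.mixin Record isTopologicalGroup G
    of PointedTopological G & Group G := {
  mulg_continuous : continuous (fun x : G * G => (x.1 * x.2)%g) ;
  invg_continuous : continuous (fun x : G => x^-1%g)
}.

#[short(type="topologicalGroupType")]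
HB.structure Definition TopologicalGroup :=
  {G of PointedTopological G & Group G & isTopologicalGroup G}.

Notation borel T := (g_sigma_algebraType (@open T)).

Definition radon (R : realType) (T : ptopologicalType)
    (m : {measure set (borel T) -> \bar R}) : Prop :=
  [/\ forall K : set T, compact K -> (m K < +oo)%E,
      forall A : set (borel T), measurable A ->
        m A = ereal_inf [set m U | U in [set U : set T | open U /\ A `<=` U]]
    & forall U : set T, open U ->
        m U = ereal_sup [set m K | K in [set K : set T | compact K /\ K `<=` U]]].

Definition left_haar (R : realType) (G : topologicalGroupType)
    (mu : {measure set (borel G) -> \bar R}) : Prop :=
  [/\ radon mu,
      (0 < mu [set: borel G])%E
    & forall (g : G) (A : set (borel G)), measurable A ->
        mu [set (g * x)%g | x in A] = mu A].

Section Length.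
Variables (R : realType) (G : topologicalGroupType) (ell : G -> R).

Definition length_function : Prop :=
  [/\ forall g, 0 <= ell g,
      ell 1%g = 0,
      forall g, ell g^-1%g = ell g
    & forall g h, ell (g * h)%g <= ell g + ell h].

Definition proper_length : Prop :=
  forall t : R, 0 <= t -> compact [set g | ell g <= t].

Definition length_zero : set G := [set g | ell g = 0].

Definition shell (S : set G) (n : nat) : set G :=
  [set g | S g /\ n%:R <= ell g < n.+1%:R].

End Length.

Section LeftCosets.
Variables (G : topologicalGroupType) (Lambda : groupClosed G).

Definition left_coset_rel (g h : G) : bool := (g^-1 * h)%g \in Lambda.

Lemma left_coset_rel_equiv : equiv_class_of left_coset_rel.
Proof.
rewrite /left_coset_rel; split=> [g|g h|h g k gh hk].
- by rewrite mulVg gpred1.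
- by rewrite -gpredV invgM invgK.
- by have := gpredM _ _ gh hk; rewrite -mulgA mulVKg.
Qed.

Canonical left_coset_equiv := EquivRelPack left_coset_rel_equiv.

End LeftCosets.

Notation left_cosets Lambda :=
  (quotient_topology {eq_quot (left_coset_rel Lambda)}).

Definition translate (G : topologicalGroupType) (Lambda : groupClosed G)
    (g : G) (q : left_cosets Lambda) : left_cosets Lambda :=
  \pi_(left_cosets Lambda) (g * repr q)%g.

Lemma translate_pi (G : topologicalGroupType) (Lambda : groupClosed G)
    (g x : G) :
  translate g (\pi_(left_cosets Lambda) x) = \pi_(left_cosets Lambda) (g * x)%g.
Proof.
apply/eqmodP; rewrite /= /left_coset_rel invgM -mulgA mulKg.
have /eqmodP : repr (\pi_(left_cosets Lambda) x) = x %[mod left_cosets Lambda].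
  by rewrite reprK.
by [].
Qed.

(* Discrete, with a nonzero finite G-invariant Radon measure on G / Lambda *)
Definition lattice (R : realType) (G : topologicalGroupType)
    (Lambda : groupClosed G) : Prop :=
  (forall g, g \in Lambda -> isolated [set x | x \in Lambda] g) /\
  exists m : {measure set (borel (left_cosets Lambda)) -> \bar R},
    [/\ radon m, (0 < m [set: borel (left_cosets Lambda)] < +oo)%E
      & forall (g : G) (A : set (borel (left_cosets Lambda))), measurable A ->
          m [set translate g q | q in A] = m A].

Section Action.
Variables (R : realType) (G : topologicalGroupType) (B : ptopologicalType).
Variables (act : G -> B -> B).

Definition is_action : Prop :=
  (forall b, act 1%g b = b) /\
  (forall g h b, act (g * h)%g b = act g (act h b)).

(* Measurability is with respect to the product of the Borel sigma-algebras. *)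
Definition measurable_action : Prop :=
  measurable_fun [set: borel G * borel B]
    (fun x : borel G * borel B => act x.1 x.2 : borel B).

Definition transitive_on (K : set G) : Prop :=
  forall b b' : B, exists2 k, K k & act k b = b'.

Variable nu : probability (borel B) R.

Definition quasi_invariant : Prop :=
  forall (g : G) (C : set (borel B)), measurable C ->
    nu C = 0%E -> nu [set act g b | b in C] = 0%E.

Definition invariant_under (K : set G) : Prop :=
  forall (k : G) (C : set (borel B)), K k -> measurable C ->
    nu [set act k b | b in C] = nu C.

(* For every g, [c g] is an everywhere positive version of the Radon-Nikodym
   derivative d(g^-1)_* nu / d nu. *)
Definition radon_nikodym_cocycle (c : G -> B -> R) : Prop :=
  [/\ forall g b, 0 < c g b,
      forall g, measurable_fun [set: borel B] (c g : borel B -> R)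
    & forall g (A : set (borel B)), measurable A ->
        pushforward nu (act g^-1%g : borel B -> borel B) A =
        (\int[nu]_(b in A) (c g b)%:E)%E].

Variable c : G -> B -> R.

Definition harish_chandra (g : G) : R :=
  \int[nu]_b Num.sqrt (c g^-1%g b).

Definition koopman (g : G) (h : B -> R[i]) (b : B) : R[i] :=
  (Num.sqrt (c g^-1%g b))%:C%C * h (act g^-1%g b).

End Action.

Section L2.
Variables (R : realType) (B : ptopologicalType) (nu : probability (borel B) R).

Definition norm2 (h : B -> R[i]) : \bar R :=
  'N[nu]_2%:E[(fun b : borel B => (ComplexField.Normc.normc (h b))%:E)]%E.

(* Functions, not classes modulo almost everywhere equality. *)
Definition L2 : set (B -> R[i]) :=
  [set h | [/\ measurable_fun [set: borel B] (fun b : borel B => complex.Re (h b)),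
               measurable_fun [set: borel B] (fun b : borel B => complex.Im (h b))
             & (norm2 h < +oo)%E]].

(* When T respects almost everywhere equality (as [koopman act c g] does when nu
   is quasi-invariant), this is the norm of the operator that T induces on the
   Hilbert space L^2(B, nu) of classes. *)
Definition opnorm22 (T : (B -> R[i]) -> B -> R[i]) : \bar R :=
  ereal_sup [set norm2 (T h) | h in [set h | L2 h /\ (norm2 h <= 1)%E]].

End L2.

(* The mean over C of the operators T g / w g, for C finite and nonempty
   ([fset_set C] is empty when C is infinite). *)
Definition weighted_mean (R : realType) (G : choiceType) (B : Type)
    (C : set G) (w : G -> R) (T : G -> (B -> R[i]) -> B -> R[i])
    (h : B -> R[i]) (b : B) : R[i] :=
  (#|` fset_set C|%:R)^-1 * \sum_(g \in C) (T g h b / (w g)%:C%C).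

(* Main.v *)
Require Import Defs.
From HB Require Import structures.
From mathcomp Require Import all_boot all_order all_algebra finmap.
From mathcomp Require Import all_classical all_reals all_analysis.
From mathcomp Require Import measurable_realfun lra complex.

Set Implicit Arguments.
Unset Strict Implicit.
Unset Printing Implicit Defensive.

Import Order.TTheory GRing.Theory Num.Theory.
Import numFieldNormedType.Exports.

Local Open Scope classical_set_scope.
Local Open Scope ring_scope.

(** Write K for the compact open group of elements of length zero, and
    w_g(b) = c(g^-1, b)^(1/2) / Xi(g), a nonnegative function of integral 1.

    The mean of the operators pi(g) / Xi(g) over a finite set C maps h to
    b |-> |C|^-1 * sum_(g in C) w_g(b) h(g^-1 b). It has nonnegative
    coefficients, and it is self-adjoint when C = C^-1, because pi is unitary
    and Xi(g^-1) = Xi(g). For such an operator the Schur test bounds the norm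
    on L^2 by the essential supremum of the image of the constant 1 (lemmas
    [schur_test] and [opnorm22_weighted_mean]). What remains is an almost
    everywhere bound on sum_(g in C) w_g by a constant times |C|, where C is
    the set of lattice points in a shell S of G.

    Since K preserves nu, uniqueness of densities gives, for k in K and almost
    every b, w_(gk)(b) = w_g(b) and w_(kg)(b) = w_g(k^-1 b). By the first
    relation w depends only on the coset gK, and a coset contains at most
    |Lambda :&: K| lattice points (a finite number when C is finite and
    nonempty, because a point of C translates Lambda :&: K into C), so the sum
    over C is at most |Lambda :&: K| times the sum over the cosets contained
    in S. By the second relation the latter sum is a K-invariant function of b, because left
    multiplication by k permutes the cosets in S. As K is transitive on B, the
    Haar average of a function over K-translates is its integral
    ([integral_transitive_average]), so a K-invariant function is constant:
    the sum over cosets equals, almost everywhere, its integral, which is the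
    number of cosets in S ([sum_weight_cosets]). This number is mu(S) / mu(K),
    which the growth hypothesis compares with |C| for all large shells; each of
    the finitely many other shells is covered by finitely many cosets.

    The relations between densities hold almost everywhere for each fixed
    group element, with an exceptional set that depends on the element. They
    are therefore used after integration over an arbitrary Borel set A, which
    turns them into equalities of numbers, and the pointwise bound is recovered
    at the end ([ae_le_of_integrals]). *)

(** * Densities and changes of variables *)

Section Density.
Local Open Scope ereal_scope.
Context d (T : measurableType d) (R : realType).

Lemma integral_indicr (mu : {measure set T -> \bar R}) A (f : T -> \bar R) :
  \int[mu]_(x in A) f x = \int[mu]_x (f x * (\1_A x)%:E).
Proof. by rewrite integral_mkcond epatch_indic. Qed.

Lemma ae_eq_of_integrals (mu : {measure set T -> \bar R}) (f g : T -> R) :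
  measurable_fun setT f -> measurable_fun setT g -> (forall x, (0 <= f x)%R) ->
  \int[mu]_x (f x)%:E < +oo ->
  (forall A, measurable A ->
     \int[mu]_(x in A) (f x)%:E = \int[mu]_(x in A) (g x)%:E) ->
  ae_eq mu setT f g.
Proof.
move=> mf mg f0 foo fg.
have : ae_eq mu setT (EFin \o f) (EFin \o g).
  apply: integral_ae_eq => //; last 2 first.
  - exact/measurable_EFinP.
  - by move=> A _ mA; exact: fg.
  apply/integrableP; split; first exact/measurable_EFinP.
  by under eq_integral do rewrite /= ger0_norm//.
by apply: filterS => x /= /[apply] -[].
Qed.

(** The hypothesis on [h] identifies it almost everywhere with the abstract
    Radon-Nikodym derivative of the image measure, for which the change of
    variables is known. *)
Lemma integral_comp_density (nu : probability T R)
    (phi : T -> T) (h : T -> R) (f : T -> \bar R) :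
  measurable_fun setT phi -> measurable_fun setT h -> (forall x, (0 <= h x)%R) ->
  (forall A, measurable A -> pushforward nu phi A = \int[nu]_(x in A) (h x)%:E) ->
  measurable_fun setT f -> (forall x, 0 <= f x) ->
  \int[nu]_x f (phi x) = \int[nu]_x (f x * (h x)%:E).
Proof.
move=> mphi mh h0 nuh mf f0.
pose X : {mfun T >-> T} := HB.pack phi (isMeasurableFun.Build _ _ _ _ phi mphi).
have mE A : distribution nu X A = pushforward nu phi A by [].
have dom : distribution nu X `<< nu.
  apply/null_content_dominatesP => A mA nuA0; rewrite mE nuh//.
  by apply: null_set_integral => //; exact/measurable_EFinP/measurable_funTS.
pose D := Radon_Nikodym_SigmaFinite.f (distribution nu X) nu.
have hD : ae_eq nu setT D (EFin \o h).
  apply: integral_ae_eq => //.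
  - exact: Radon_Nikodym_SigmaFinite.f_integrable.
  - exact/measurable_EFinP.
  - move=> A _ mA; rewrite -nuh// -mE.
    exact/esym/(Radon_Nikodym_SigmaFinite.f_integral dom).
transitivity (\int[distribution nu X]_x f x).
  by rewrite ge0_integral_distribution.
rewrite -(@Radon_Nikodym_SigmaFinite.change_of_variables _ _ _ _ nu)//.
apply: ae_eq_integral => //.
- apply: emeasurable_funM => //.
  exact: measurable_int (Radon_Nikodym_SigmaFinite.f_integrable _).
- by apply: emeasurable_funM => //; exact/measurable_EFinP.
- exact: ae_eqe_mul2l.
Qed.
End Density.

(** * Square roots of the Radon-Nikodym cocycle *)

Section KoopmanWeights.
Local Open Scope ereal_scope.
Variables (R : realType) (G : topologicalGroupType) (B : ptopologicalType).
Variables (nu : probability (borel B) R) (act : G -> B -> B) (c : G -> B -> R).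
Hypothesis act_action : is_action act.
Hypothesis act_measurable : measurable_action act.
Hypothesis c_cocycle : radon_nikodym_cocycle act nu c.

Definition koopman_weight (g : G) (b : B) : R := Num.sqrt (c g^-1%g b).

(** The function w_g of the overview: its sum over a set [C] is, up to the
    factor |C|, the image of the constant 1 under the mean over [C]. *)
Definition normalized_weight (g : G) (b : B) : R :=
  (koopman_weight g b / harish_chandra nu c g)%R.

Lemma actK g b : act g^-1%g (act g b) = b.
Proof. by case: act_action => a1 aM; rewrite -aM mulVg a1. Qed.

Lemma actVK g b : act g (act g^-1%g b) = b.
Proof. by case: act_action => a1 aM; rewrite -aM mulgV a1. Qed.

Lemma preimage_act g A : act g @^-1` A = act g^-1%g @` A.
Proof.
apply/seteqP; split => [b /= Agb|_ [b Ab <-]]; last by rewrite /= actVK.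
by exists (act g b) => //; rewrite actK.
Qed.

Lemma measurable_act g : measurable_fun setT (act g : borel B -> borel B).
Proof.
exact: (measurableT_comp act_measurable (@pair1_measurable _ _ (borel G) (borel B) g)).
Qed.

Lemma measurable_cocycle g : measurable_fun setT (c g : borel B -> R).
Proof. by case: c_cocycle. Qed.

Lemma cocycle_gt0 g b : (0 < c g b)%R. Proof. by case: c_cocycle. Qed.

Lemma cocycle_ge0 g b : (0 <= c g b)%R. Proof. exact/ltW/cocycle_gt0. Qed.

Lemma integral_act g (f : borel B -> \bar R) :
  measurable_fun setT f -> (forall b, 0 <= f b) ->
  \int[nu]_b f (act g^-1%g b) = \int[nu]_b (f b * (c g b)%:E).
Proof.
move=> mf f0; apply: (@integral_comp_density _ (borel B) R nu (act g^-1%g) (c g)) => //.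
- exact: measurable_act.
- exact: measurable_cocycle.
- exact: cocycle_ge0.
- by case: c_cocycle => _ _ cE A mA; exact: cE.
Qed.

Lemma integral_cocycle g : \int[nu]_b (c g b)%:E = 1.
Proof.
have := @integral_act g (cst 1) (measurable_cst _) (fun=> lee01).
rewrite integral_cst// mul1e; under [RHS]eq_integral do rewrite mul1e.
by move=> <-; exact: probability_setT.
Qed.

Lemma koopman_weight_gt0 g b : (0 < koopman_weight g b)%R.
Proof. by rewrite sqrtr_gt0 cocycle_gt0. Qed.

Lemma koopman_weight_ge0 g b : (0 <= koopman_weight g b)%R.
Proof. exact/ltW/koopman_weight_gt0. Qed.

Lemma measurable_koopman_weight g :
  measurable_fun setT (koopman_weight g : borel B -> R).
Proof.
apply: measurableT_comp (measurable_cocycle g^-1%g).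
exact: continuous_measurable_fun (@sqrt_continuous R).
Qed.

Lemma measurable_EFin_koopman_weight g :
  measurable_fun setT (fun b : borel B => (koopman_weight g b)%:E).
Proof. by apply/measurable_EFinP; exact: measurable_koopman_weight. Qed.

(** Comparison with [1 + c], because sqrt t <= 1 + t. *)
Lemma integral_koopman_weight_fin g : \int[nu]_b (koopman_weight g b)%:E < +oo.
Proof.
apply: (@le_lt_trans _ _ (\int[nu]_b ((cst 1 b)%:E + (c g^-1%g b)%:E))).
  apply: ge0_le_integral => //.
  - by move=> b _; rewrite lee_fin koopman_weight_ge0.
  - apply/measurable_EFinP; exact: measurable_koopman_weight.
  - apply: emeasurable_funD; first by apply/measurable_EFinP.
    apply/measurable_EFinP; exact: measurable_cocycle.
  move=> b _ /=; rewrite -EFinD lee_fin /koopman_weight.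
  by have := sqr_sqrtr (cocycle_ge0 g^-1%g b); nra.
rewrite ge0_integralD//.
- have := integral_cst nu (measurableT : measurable [set: borel B]) 1.
  rewrite integral_cocycle => ->.
  by rewrite mul1e [X in X + _](_ : _ = 1) ?ltry//; exact: probability_setT.
- by apply/measurable_EFinP.
- by move=> b _; rewrite lee_fin cocycle_ge0.
- apply/measurable_EFinP; exact: measurable_cocycle.
Qed.

Lemma harish_chandraE g :
  (harish_chandra nu c g)%:E = \int[nu]_b (koopman_weight g b)%:E.
Proof.
rewrite /harish_chandra /Rintegral fineK// ge0_fin_numE.
  exact: integral_koopman_weight_fin.
by apply: integral_ge0 => b _; rewrite lee_fin koopman_weight_ge0.
Qed.

Lemma harish_chandra_gt0 g : (0 < harish_chandra nu c g)%R.
Proof.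
rewrite -lte_fin harish_chandraE lt0e.
apply/andP; split; last first.
  by apply: integral_ge0 => b _; rewrite lee_fin koopman_weight_ge0.
apply/eqP => I0.
have /ae_eq_integral_abs : \int[nu]_b `|(koopman_weight g b)%:E| = 0.
  by under eq_integral do rewrite gee0_abs ?lee_fin ?koopman_weight_ge0//.
case=> //; first by apply/measurable_EFinP; exact: measurable_koopman_weight.
move=> N [mN N0 psi0]; suff NT : N = setT.
  have := @probability_setT _ _ _ nu; rewrite -NT N0 => /eqP.
  by rewrite eqe eq_sym oner_eq0.
apply/seteqP; split => // b _; apply: psi0 => /= /(_ I) [psi_b].
by have := koopman_weight_gt0 g b; rewrite psi_b ltxx.
Qed.

Lemma measurable_comp_act d (T : measurableType d) g (f : borel B -> T) :
  measurable_fun setT f -> measurable_fun setT (fun b : borel B => f (act g b)).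
Proof. by move=> mf; apply: measurableT_comp mf (measurable_act g). Qed.

Lemma ae_eq_cocycle g (f : borel B -> R) : measurable_fun setT f ->
  (forall A, measurable A ->
    \int[nu]_(b in A) (c g b)%:E = \int[nu]_(b in A) (f b)%:E) ->
  ae_eq nu setT (c g : borel B -> R) f.
Proof.
move=> mf cf; apply: ae_eq_of_integrals => //.
- exact: measurable_cocycle.
- exact: cocycle_ge0.
- by rewrite integral_cocycle ltry.
Qed.

Lemma measurable_EFin_indic (A : set (borel B)) : measurable A ->
  measurable_fun setT (fun b : borel B => (\1_A b : R)%:E).
Proof. by move=> mA; apply/measurable_EFinP; exact: measurable_indic. Qed.

Lemma cocycle1_ae : ae_eq nu setT (c 1%g : borel B -> R) (cst 1%R).
Proof.
apply: ae_eq_cocycle => // A mA; rewrite integral_indicr [RHS]integral_indicr.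
under eq_integral do rewrite muleC.
rewrite -integral_act//; last exact: measurable_EFin_indic.
by case: act_action => a1 _; apply: eq_integral => b _; rewrite invg1 a1 mul1e.
Qed.

(** The cocycle identity for the pair [g^-1], [g]: both functions are densities
    of [nu] with respect to itself. *)
Lemma cocycleV_ae g :
  ae_eq nu setT (fun b : borel B => c g^-1%g (act g b) * c g b)%R (cst 1%R).
Proof.
have mcg : measurable_fun setT (fun b : borel B => c g^-1%g (act g b)).
  by apply: measurable_comp_act; exact: measurable_cocycle.
suff : ae_eq nu setT (c 1%g : borel B -> R)
    (fun b : borel B => c g^-1%g (act g b) * c g b)%R.
  move=> h; apply: ae_eq_trans (ae_eq_sym h) cocycle1_ae.
apply: ae_eq_cocycle.
  by apply: measurable_funM => //; exact: measurable_cocycle.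
move=> A mA; rewrite integral_indicr [RHS]integral_indicr.
have m1A := measurable_EFin_indic mA.
have m1Ag := measurable_comp_act g^-1%g m1A.
transitivity (\int[nu]_b (\1_A b : R)%:E).
  under eq_integral do rewrite muleC.
  rewrite -integral_act//.
  by case: act_action => a1 _; apply: eq_integral => b _; rewrite invg1 a1.
transitivity (\int[nu]_b ((c g^-1%g (act g b))%:E * (\1_A b)%:E * (c g b)%:E));
  last first.
  by apply: eq_integral => b _; rewrite EFinM muleAC.
rewrite -(@integral_act g (fun b => (c g^-1%g (act g b))%:E * (\1_A b)%:E)); last 2 first.
- by apply: emeasurable_funM => //; apply/measurable_EFinP.
- by move=> b; rewrite mule_ge0 ?lee_fin ?cocycle_ge0.
under [RHS]eq_integral do rewrite actVK muleC.
rewrite -(@integral_act g^-1%g (fun b => (\1_A (act g^-1%g b))%:E))//.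
by apply: eq_integral => b _; rewrite actVK.
Qed.

(** Unitarity of the Koopman representation, in the form used for
    self-adjointness: substituting [g b] for [b] multiplies the measure by
    [c g b], and [cocycleV_ae] turns the product of the square root of
    [c g^-1 (g b)] with [c g b] into the square root of [c g b]. *)
Lemma koopman_weight_duality g (f : borel B -> \bar R) :
  measurable_fun setT f -> (forall b, 0 <= f b) ->
  \int[nu]_b ((koopman_weight g b)%:E * f (act g^-1%g b)) =
  \int[nu]_b ((koopman_weight g^-1%g b)%:E * f b).
Proof.
move=> mf f0.
have mw : measurable_fun setT (fun b : borel B => (koopman_weight g (act g b))%:E).
  apply/measurable_EFinP; apply: measurable_comp_act.
  exact: measurable_koopman_weight.
have := @integral_act g (fun b => (koopman_weight g (act g b))%:E * f b).
under eq_integral do rewrite actVK.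
move=> ->; last 2 first.
- exact: emeasurable_funM.
- by move=> b; rewrite mule_ge0 ?lee_fin ?koopman_weight_ge0.
apply: ae_eq_integral => //.
- apply: emeasurable_funM; first exact: emeasurable_funM.
  by apply/measurable_EFinP; exact: measurable_cocycle.
- apply: emeasurable_funM => //.
  by apply/measurable_EFinP; exact: measurable_koopman_weight.
apply: filterS (cocycleV_ae g) => b /= /[apply] cV.
rewrite muleAC -EFinM; congr (_%:E * _).
rewrite /koopman_weight invgK -{1}(sqr_sqrtr (cocycle_ge0 g b)) expr2 mulrA.
by rewrite -sqrtrM ?cocycle_ge0// cV sqrtr1 mul1r.
Qed.

Lemma harish_chandraV g : harish_chandra nu c g^-1%g = harish_chandra nu c g.
Proof.
apply: EFin_inj; rewrite !harish_chandraE.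
have := @koopman_weight_duality g (cst 1) (measurable_cst _) (fun=> lee01).
by under eq_integral do rewrite mule1; under [RHS]eq_integral do rewrite mule1.
Qed.

Lemma integral_cocycle_image g (A : set (borel B)) : measurable A ->
  \int[nu]_(b in A) (c g b)%:E = nu (act g @` A).
Proof.
move=> mA; case: c_cocycle => _ _ <-//.
by rewrite /pushforward preimage_act invgK.
Qed.

Lemma measurable_act_image g (A : set (borel B)) : measurable A ->
  measurable (act g @` A : set (borel B)).
Proof.
move=> mA; rewrite -[g]invgK -preimage_act -[X in measurable X]setTI.
exact: measurable_act.
Qed.

Lemma act_imageM g h (A : set B) : act (g * h)%g @` A = act g @` (act h @` A).
Proof.
case: act_action => _ aM; rewrite image_comp.
by apply: eq_imagel => b _; rewrite aM.
Qed.

Variable K : set G.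
Hypothesis KV : forall k, K k -> K k^-1%g.
Hypothesis K_invariant : invariant_under act nu K.

Lemma integral_act_invariant k (f : borel B -> \bar R) : K k ->
  measurable_fun setT f -> (forall b, 0 <= f b) ->
  \int[nu]_b f (act k b) = \int[nu]_b f b.
Proof.
move=> Kk mf f0.
rewrite (@integral_comp_density _ (borel B) R nu (act k) (cst 1%R))//.
- by apply: eq_integral => b _; rewrite mule1.
- exact: measurable_act.
- move=> A mA; rewrite /pushforward preimage_act K_invariant//; last exact: KV.
  by rewrite (integral_cst nu mA 1) mul1e.
Qed.

(** The left factor [k] acts last and preserves [nu], so a Borel set has images
    of the same measure under [k g] and under [g]. *)
Lemma cocycle_mull k g : K k ->
  ae_eq nu setT (c (k * g)%g : borel B -> R) (c g).
Proof.
move=> Kk; apply: ae_eq_cocycle; first exact: measurable_cocycle.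
move=> A mA; rewrite !integral_cocycle_image// act_imageM (K_invariant Kk)//.
exact: measurable_act_image.
Qed.

(** The right factor [k] acts first: the integral of [c g] over [k A] is
    brought back to [A] by the invariance of [nu] under [k]. *)
Lemma cocycle_mulr k g : K k ->
  ae_eq nu setT (c (g * k)%g : borel B -> R) (fun b : borel B => c g (act k b)).
Proof.
move=> Kk; have mcg := measurable_comp_act k (measurable_cocycle g).
apply: ae_eq_cocycle => // A mA.
rewrite integral_cocycle_image// act_imageM -integral_cocycle_image//; last first.
  exact: measurable_act_image.
rewrite integral_indicr [RHS]integral_indicr.
rewrite -(@integral_act_invariant k)//.
- apply: eq_integral => b _; congr (_ * (_ %:E)); rewrite !indicE; congr (_%:R).
  congr nat_of_bool; apply/idP/idP; rewrite !inE.
    by move=> [b' Ab' /(congr1 (act k^-1%g))]; rewrite !actK => <-.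
  by move=> Ab; exists b.
- apply: emeasurable_funM; first by apply/measurable_EFinP; exact: measurable_cocycle.
  exact: measurable_EFin_indic (measurable_act_image k mA).
- by move=> b; rewrite mule_ge0 ?lee_fin ?cocycle_ge0.
Qed.

Lemma koopman_weight_mulr k g : K k ->
  ae_eq nu setT (koopman_weight (g * k)%g : borel B -> R) (koopman_weight g).
Proof.
move=> Kk; apply: filterS (@cocycle_mull k^-1%g g^-1%g (KV Kk)) => b /= /[apply].
by rewrite /koopman_weight invgM => ->.
Qed.

Lemma koopman_weight_mull k g : K k ->
  ae_eq nu setT (koopman_weight (k * g)%g : borel B -> R)
    (fun b : borel B => koopman_weight g (act k^-1%g b)).
Proof.
move=> Kk; apply: filterS (@cocycle_mulr k^-1%g g^-1%g (KV Kk)) => b /= /[apply].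
by rewrite /koopman_weight invgM => ->.
Qed.

Lemma harish_chandra_mulr k g : K k ->
  harish_chandra nu c (g * k)%g = harish_chandra nu c g.
Proof.
move=> Kk; apply: EFin_inj; rewrite !harish_chandraE.
apply: ae_eq_integral => //; [exact: measurable_EFin_koopman_weight..|].
by apply: filterS (koopman_weight_mulr g Kk) => b /= /[apply] ->.
Qed.

Lemma harish_chandra_mull k g : K k ->
  harish_chandra nu c (k * g)%g = harish_chandra nu c g.
Proof.
move=> Kk; rewrite -harish_chandraV invgM harish_chandra_mulr; last exact: KV.
exact: harish_chandraV.
Qed.

Lemma normalized_weight_mulr k g : K k ->
  ae_eq nu setT (normalized_weight (g * k)%g : borel B -> R) (normalized_weight g).
Proof.
move=> Kk; apply: filterS (koopman_weight_mulr g Kk) => b /= /[apply].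
by rewrite /normalized_weight harish_chandra_mulr// => ->.
Qed.

Lemma normalized_weight_mull k g : K k ->
  ae_eq nu setT (normalized_weight (k * g)%g : borel B -> R)
    (fun b : borel B => normalized_weight g (act k^-1%g b)).
Proof.
move=> Kk; apply: filterS (koopman_weight_mull g Kk) => b /= /[apply].
by rewrite /normalized_weight harish_chandra_mull// => ->.
Qed.

Lemma normalized_weight_ge0 g b : (0 <= normalized_weight g b)%R.
Proof. by rewrite divr_ge0 ?koopman_weight_ge0// ltW// harish_chandra_gt0. Qed.

Lemma measurable_EFin_normalized_weight g :
  measurable_fun setT (fun b : borel B => (normalized_weight g b)%:E).
Proof.
apply/measurable_EFinP; apply: measurable_funM => //.
exact: measurable_koopman_weight.
Qed.

Lemma integral_normalized_weight g :
  \int[nu]_b (normalized_weight g b)%:E = 1.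
Proof.
under eq_integral do rewrite /normalized_weight EFinM.
rewrite ge0_integralZr//.
- rewrite -harish_chandraE -EFinM divff// gt_eqF//.
  exact: harish_chandra_gt0.
- exact: measurable_EFin_koopman_weight.
- by move=> b _; rewrite lee_fin koopman_weight_ge0.
- by rewrite lee_fin invr_ge0 ltW// harish_chandra_gt0.
Qed.

End KoopmanWeights.

(** * Tonelli on subsets and Borel maps *)

Lemma tonelli_on (d1 d2 : measure_display) (X : measurableType d1)
    (Y : measurableType d2) (R : realType)
    (mu : {measure set X -> \bar R}) (nu : {finite_measure set Y -> \bar R})
    (D : set X) (A : set Y) (f : X * Y -> \bar R) :
  measurable D -> (mu D < +oo)%E -> measurable A ->
  measurable_fun setT f -> (forall z, 0 <= f z)%E ->
  (\int[mu]_(x in D) \int[nu]_(y in A) f (x, y) =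
   \int[nu]_(y in A) \int[mu]_(x in D) f (x, y))%E.
Proof.
move=> mD Doo mA mf f0.
pose k := mfrestr mD Doo.
have kE (g : X -> \bar R) :
    (\int[mu]_(x in D) g x = \int[k]_x (g x * (\1_D x)%:E))%E.
  rewrite -integral_indicr; apply: eq_measure_integral => B mB BD.
  by rewrite /= /mfrestr /mrestr setIidl.
pose g z := (f z * (\1_D z.1)%:E * (\1_A z.2)%:E)%E.
have mg : measurable_fun setT g.
  apply: emeasurable_funM; last first.
    by apply/measurable_EFinP; apply: measurableT_comp => //; exact: measurable_indic.
  apply: emeasurable_funM => //.
  by apply/measurable_EFinP; apply: measurableT_comp => //; exact: measurable_indic.
have g0 z : (0 <= g z)%E by rewrite !mule_ge0// lee_fin.
have mfx x : measurable_fun setT (fun y => f (x, y)) by exact: measurableT_comp.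
have mfy y : measurable_fun setT (fun x => f (x, y)) by exact: measurableT_comp.
rewrite kE [RHS]integral_indicr.
transitivity (\int[k]_x \int[nu]_y g (x, y))%E.
  apply: eq_integral => x _; rewrite integral_indicr -ge0_integralZr//.
  - by apply: eq_integral => y _; rewrite /g/= muleAC.
  - apply: emeasurable_funM => //; apply/measurable_EFinP; exact: measurable_indic.
  - by move=> y _; rewrite mule_ge0// lee_fin.
rewrite (fubini_tonelli g)//.
apply: eq_integral => y _; rewrite kE -ge0_integralZr//.
- apply: emeasurable_funM => //; apply/measurable_EFinP; exact: measurable_indic.
- by move=> x _; rewrite mule_ge0// lee_fin.
Qed.

(** Applied to one variable of the group law at a time: the Borel sets of a
    product may exceed the product sigma-algebra. *)
Lemma continuous_borel_measurable (S T : ptopologicalType) (f : S -> T) :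
  continuous f -> measurable_fun setT (f : borel S -> borel T).
Proof.
move=> cf.
apply: (@measurability _ _ (borel S) (borel T) setT f (@open T)) => // _ [U oU <-].
rewrite setTI; apply: sub_sigma_algebra; by move/continuousP : cf; exact.
Qed.

(** * Haar averages over a transitive open subgroup *)

Section TransitiveAverage.
Local Open Scope ereal_scope.
Variables (R : realType) (G : topologicalGroupType).
Variable mu : {measure set (borel G) -> \bar R}.
Hypothesis mu_haar : left_haar mu.

Lemma continuous_mulgl (g : G) : continuous (fun x : G => (g * x)%g).
Proof.
move=> x.
have h : (g, y) @[y --> x] --> (g, x).
  by apply: (@cvg_pair _ _ _ _ (nbhs g)); [exact: cvg_cst|exact: cvg_id].
exact: (cvg_comp _ _ h (@mulg_continuous G (g, x))).
Qed.

Lemma measurable_mulgl (g : G) :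
  measurable_fun setT ((fun x : G => (g * x)%g) : borel G -> borel G).
Proof. exact: (@continuous_borel_measurable G G _ (@continuous_mulgl g)). Qed.

Lemma measurable_invg : measurable_fun setT ((fun x : G => x^-1%g) : borel G -> borel G).
Proof. exact: (@continuous_borel_measurable G G _ (@invg_continuous G)). Qed.

Lemma mulgl_preimage (g : G) (A : set G) :
  (fun x => (g * x)%g) @^-1` A = [set (g^-1 * x)%g | x in A].
Proof.
apply/seteqP; split => [x /= Agx|_ [x Ax <-]]; last by rewrite /= mulVKg.
by exists (g * x)%g => //; rewrite mulKg.
Qed.

Lemma haar_mulgl_preimage (g : G) (A : set (borel G)) : measurable A ->
  mu ((fun x => (g * x)%g) @^-1` A) = mu A.
Proof. by move=> mA; rewrite mulgl_preimage; case: mu_haar => _ _ ->. Qed.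

Variable K : set G.
Hypothesis KV : forall k, K k -> K k^-1%g.
Hypothesis KM : forall k l, K k -> K l -> K (k * l)%g.
Hypothesis K_open : open K.
Hypothesis K_fin : mu K < +oo.

Lemma measurable_open_subgroup : measurable (K : set (borel G)).
Proof. exact: sub_sigma_algebra. Qed.

Variables (B : ptopologicalType) (nu : probability (borel B) R).
Variable act : G -> B -> B.
Hypothesis act_action : is_action act.
Hypothesis act_measurable : measurable_action act.
Hypothesis K_transitive : transitive_on act K.
Hypothesis K_invariant : invariant_under act nu K.

Variable f : borel B -> \bar R.
Hypothesis mf : measurable_fun setT f.
Hypothesis f0 : forall b, 0 <= f b.

Let orbit_integral (b : B) := \int[mu]_(k in K) f (act k^-1%g b).

Let measurable_orbit_map :
  measurable_fun setT (fun z : borel G * borel B => f (act z.1^-1%g z.2)).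
Proof.
apply: (measurableT_comp mf).
exact: (measurableT_comp act_measurable (measurable_fun_pair
  (measurableT_comp measurable_invg measurable_fst) measurable_snd)).
Qed.

(** Left invariance, after the substitution of [k0 k] for [k]. *)
Let orbit_integral_act k0 b : K k0 ->
  orbit_integral (act k0 b) = orbit_integral b.
Proof.
move=> Kk0; rewrite /orbit_integral.
have mK := measurable_open_subgroup.
have mfb : measurable_fun setT (fun k : borel G => f (act k^-1%g (act k0 b))).
  exact: (measurableT_comp measurable_orbit_map
    (@pair2_measurable _ _ (borel G) (borel B) (act k0 b))).
have K_pre : (fun x => (k0 * x)%g) @^-1` K = K.
  apply/seteqP; split=> k /= Kk; last exact: KM.
  by rewrite -(mulKg k0 k); apply: KM => //; exact: KV.
transitivity (\int[pushforward mu ((fun x : G => (k0 * x)%g) : borel G -> borel G)]_(k in K)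
    f (act k^-1%g (act k0 b))).
  apply: eq_measure_integral => [|mtr A mA _]; first exact: measurable_mulgl.
  by rewrite -(haar_mulgl_preimage k0 mA).
rewrite ge0_integral_pushforward//.
- rewrite K_pre; apply: eq_integral => k _ /=.
  by case: act_action => a1 aM; rewrite -aM invgM -mulgA mulVg mulg1.
- exact: measurable_mulgl.
- exact: measurable_funTS.
Qed.

Let orbit_integral_const b b' : orbit_integral b = orbit_integral b'.
Proof.
by have [k Kk <-] := K_transitive b b'; rewrite orbit_integral_act.
Qed.

(** By left invariance of the Haar measure, the integral over [K] of
    [f (k^-1 b)] takes the same value at [b] and at [k0 b], hence at all points
    of [B] by transitivity; integrating over [B] and exchanging the integrals
    identifies this value as [mu K] times the integral of [f]. *)
Lemma integral_transitive_average (A : set (borel B)) : measurable A ->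
  \int[mu]_(k in K) \int[nu]_(b in A) f (act k^-1%g b) =
  mu K * nu A * \int[nu]_b f b.
Proof.
have orbitE (D : set (borel B)) : measurable D ->
    \int[mu]_(k in K) \int[nu]_(b in D) f (act k^-1%g b) =
    orbit_integral point * nu D.
  move=> mD.
  rewrite (tonelli_on _ measurable_open_subgroup K_fin mD measurable_orbit_map)//.
  rewrite -(integral_cst nu mD); apply: eq_integral => b _.
  exact: orbit_integral_const.
have := orbitE setT measurableT.
rewrite (_ : nu setT = 1) ?mule1; last exact: probability_setT.
move=> orbit1 mA; rewrite orbitE// -orbit1 muleAC; congr (_ * _).
transitivity (\int[mu]_(k in K) (cst (\int[nu]_b f b) k)).
  apply: eq_integral => k /set_mem Kk.
  rewrite (@integral_act_invariant _ _ _ nu act act_action act_measurable K)//.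
  exact: KV.
by rewrite (integral_cst mu measurable_open_subgroup) muleC.
Qed.

End TransitiveAverage.

(** * Cosets of an open subgroup *)

(** Each value [F y] occurs once per element of the fiber of [r] over [y]. *)
Lemma sum_fibers_le (R : realType) (S T : eqType) (s : seq S) (t : seq T)
    (r : S -> T) (F : T -> \bar R) (m : nat) :
  uniq t -> {in s, forall x, r x \in t} -> (forall y, 0 <= F y)%E ->
  {in t, forall y, (count (fun x => r x == y) s <= m)%N} ->
  (\sum_(x <- s) F (r x) <= m%:R%:E * \sum_(y <- t) F y)%E.
Proof.
move=> ut st F0 sm.
have -> : (\sum_(x <- s) F (r x) =
    \sum_(y <- t) \sum_(x <- s | r x == y) F y)%E.
  rewrite (exchange_big_dep xpredT)//= big_seq [RHS]big_seq.
  apply: eq_bigr => x xs; under eq_bigl do rewrite eq_sym.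
  rewrite big_mkcond (bigD1_seq (r x)) ?st//= eqxx big1 ?addr0// => y.
  by rewrite eq_sym => /negbTE ->.
rewrite ge0_sume_distrr// big_seq [leRHS]big_seq.
apply: lee_sum => y yt.
rewrite big_const_seq.
have -> k : iter k (fun x => F y + x)%E 0%E = (k%:R%:E * F y)%E.
  elim: k => [|k /= ->]; first by rewrite mul0e.
  by rewrite -nat1r EFinD ge0_muleDl ?lee_fin// mul1e.
by apply: lee_wpmul2r => //; rewrite lee_fin ler_nat sm.
Qed.

Section OpenCosets.
Local Open Scope ereal_scope.
Variables (R : realType) (G : topologicalGroupType).
Variable mu : {measure set (borel G) -> \bar R}.
Hypothesis mu_haar : left_haar mu.
Variable K : set G.
Hypothesis K1 : K 1%g.
Hypothesis KV : forall k, K k -> K k^-1%g.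
Hypothesis KM : forall k l, K k -> K l -> K (k * l)%g.
Hypothesis K_open : open K.

Definition open_coset (g : G) : set G := (fun x => (g^-1 * x)%g) @^-1` K.

(** [xget] depends only on the set it chooses from, so equal cosets have equal
    representatives; the image of a set under [coset_rep] is thus a
    transversal of the cosets that it meets. *)
Definition coset_rep (g : G) : G := xget 1%g (open_coset g).

Lemma coset_refl g : open_coset g g.
Proof. by rewrite /open_coset /= mulVg. Qed.

Lemma coset_sym g h : open_coset g h -> open_coset h g.
Proof. by move=> /KV; rewrite /open_coset /= invgM invgK. Qed.

Lemma coset_trans g h k : open_coset g h -> open_coset h k -> open_coset g k.
Proof. by move=> gh /(KM gh); rewrite /open_coset /= -mulgA mulVKg. Qed.

Lemma coset_repP g : open_coset g (coset_rep g).
Proof. by rewrite /coset_rep; case: xgetP => //= /(_ g); have := coset_refl g. Qed.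

Lemma eq_coset_rep g h : open_coset g h -> coset_rep g = coset_rep h.
Proof.
move=> gh; congr (xget _ _); apply/seteqP; split => x; apply: coset_trans => //.
exact: coset_sym.
Qed.

Lemma coset_rep_inj g h : coset_rep g = coset_rep h -> open_coset g h.
Proof.
move=> gh; apply: coset_trans (coset_repP g) _.
by rewrite gh; exact/coset_sym/coset_repP.
Qed.

Lemma coset_repK g : coset_rep (coset_rep g) = coset_rep g.
Proof. exact/esym/eq_coset_rep/coset_repP. Qed.

Lemma coset_mull k g h : open_coset (k * g)%g (k * h)%g <-> open_coset g h.
Proof. by rewrite /open_coset /= invgM -mulgA mulKg. Qed.

Lemma open_coset_open g : open (open_coset g).
Proof. by have /continuousP := @continuous_mulgl G g^-1%g; exact. Qed.

Lemma measurable_coset g : measurable (open_coset g : set (borel G)).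
Proof. by apply: sub_sigma_algebra; exact: open_coset_open. Qed.

Lemma haar_coset g : mu (open_coset g) = mu K.
Proof.
by rewrite haar_mulgl_preimage//; apply: measurable_open_subgroup.
Qed.

Lemma finite_coset_rep (Q : set G) : compact Q -> finite_set (coset_rep @` Q).
Proof.
rewrite compact_cover => /(_ G setT open_coset) []//.
- by move=> g _; exact: open_coset_open.
- by move=> g _; exists g => //; exact: coset_refl.
move=> D _ QD; apply: (@sub_finite_set _ _ (coset_rep @` [set` D])).
  move=> _ [g Qg <-]; have [h hD hg] := QD g Qg.
  by exists h => //; exact: eq_coset_rep.
exact/finite_image/finite_fset.
Qed.

Lemma trivIset_coset (Q : set G) : trivIset (coset_rep @` Q) open_coset.
Proof.
move=> _ _ [g _ <-] [h _ <-] [x [gx hx]].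
rewrite -(coset_repK g) -(coset_repK h); apply: eq_coset_rep.
exact: coset_trans gx (coset_sym hx).
Qed.

Lemma haar_cosets (Q : set G) : finite_set (coset_rep @` Q) ->
  mu (\bigcup_(g in coset_rep @` Q) open_coset g) =
  (#|` fset_set (coset_rep @` Q)|%:R)%:E * mu K.
Proof.
move=> fQ; rewrite measure_fin_bigcup//; last 2 first.
- exact: trivIset_coset.
- by move=> g _; exact: measurable_coset.
rewrite fsbig_finite// (eq_bigr (fun=> mu K)); last by move=> g _; exact: haar_coset.
rewrite big_const_seq count_predT; elim: size => [|n /= ->].
  by rewrite mul0e.
by rewrite -nat1r EFinD ge0_muleDl ?lee_fin// mul1e.
Qed.

(** If [mu K] were zero, compact sets, being covered by finitely many cosets,
    would be null, and so would the whole group by inner regularity. *)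
Lemma haar_open_subgroup_gt0 : hausdorff_space G -> 0 < mu K.
Proof.
move=> hG; rewrite lt0e measure_ge0 andbT; apply/eqP => K0.
case: mu_haar => -[_ _ inner] + _; rewrite inner; last exact: openT.
apply/negP; rewrite -leNgt; apply: ge_ereal_sup => _ [Q [cQ _] <-].
have fQ := finite_coset_rep cQ.
apply: (@le_trans _ _ (mu (\bigcup_(g in coset_rep @` Q) open_coset g))).
  apply: le_measure; rewrite ?inE.
  - rewrite -[X in measurable X]setCK; apply: measurableC.
    apply: sub_sigma_algebra; rewrite /= openC; exact: compact_closed.
  - by apply: fin_bigcup_measurable => // g _; exact: measurable_coset.
  - move=> g Qg; exists (coset_rep g); first by exists g.
    exact/coset_sym/coset_repP.
by rewrite haar_cosets// K0 mule0.
Qed.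

Variable S : set G.
Hypothesis S_mull : forall k g, K k -> S g -> S (k * g)%g.
Hypothesis S_mulr : forall g k, S g -> K k -> S (g * k)%g.
Hypothesis S_finite : finite_set (coset_rep @` S).

Let D := coset_rep @` S.

Lemma invariant_coset g h : S g -> open_coset g h -> S h.
Proof. by move=> Sg /(S_mulr Sg); rewrite mulVKg. Qed.

Lemma haar_invariant_set : mu S = (#|` fset_set D|%:R)%:E * mu K.
Proof.
rewrite -haar_cosets//; congr (mu _); apply/seteqP; split => [g Sg|g [_ [h Sh <-]]].
  exists (coset_rep g); first by exists g.
  exact/coset_sym/coset_repP.
by apply: invariant_coset; apply: invariant_coset Sh (coset_repP h).
Qed.

Lemma coset_rep_mull_bij k : K k -> set_bij D D (fun g => coset_rep (k * g)%g).
Proof.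
move=> Kk; split.
- move=> _ [g Sg <-]; exists (k * coset_rep g)%g => //.
  by apply: S_mull => //; exact: invariant_coset Sg (coset_repP g).
- move=> _ _ /set_mem[g _ <-] /set_mem[h _ <-] /coset_rep_inj /coset_mull.
  by move=> /eq_coset_rep; rewrite !coset_repK.
- move=> _ [g Sg <-]; exists (coset_rep (k^-1 * g)%g).
    by exists (k^-1 * g)%g => //; apply: S_mull => //; exact: KV.
  apply: eq_coset_rep; apply: coset_sym; rewrite -{1}(mulVKg k g).
  by apply/coset_mull; exact: coset_repP.
Qed.

Variables (B : ptopologicalType) (nu : probability (borel B) R).
Variables (act : G -> B -> B) (c : G -> B -> R).
Hypothesis act_action : is_action act.
Hypothesis act_measurable : measurable_action act.
Hypothesis c_cocycle : radon_nikodym_cocycle act nu c.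
Hypothesis K_transitive : transitive_on act K.
Hypothesis K_invariant : invariant_under act nu K.
Hypothesis K_fin : mu K < +oo.
Hypothesis K_gt0 : 0 < mu K.

Local Notation weight := (normalized_weight nu c).

Lemma integral_weight_mulr g k (A : set (borel B)) : K k -> measurable A ->
  \int[nu]_(b in A) (weight (g * k)%g b)%:E = \int[nu]_(b in A) (weight g b)%:E.
Proof.
move=> Kk mA.
have mw h : measurable_fun A (fun b : borel B => (weight h b)%:E).
  apply: measurable_funTS; exact: measurable_EFin_normalized_weight c_cocycle h.
apply: ae_eq_integral => //.
have := @normalized_weight_mulr _ _ _ nu act c act_action act_measurable
  c_cocycle K KV K_invariant k g Kk.
by apply: filterS => b /= /(_ I) ->.
Qed.

Lemma integral_weight_mull g k (A : set (borel B)) : K k -> measurable A ->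
  \int[nu]_(b in A) (weight (k * g)%g b)%:E =
  \int[nu]_(b in A) (weight g (act k^-1%g b))%:E.
Proof.
move=> Kk mA; have mw h := measurable_EFin_normalized_weight c_cocycle h.
apply: ae_eq_integral => //.
- exact: measurable_funTS.
- apply: measurable_funTS; exact: measurable_comp_act (mw g).
have := @normalized_weight_mull _ _ _ nu act c act_action act_measurable
  c_cocycle K KV K_invariant k g Kk.
by apply: filterS => b /= /(_ I) ->.
Qed.

Lemma integral_weight_coset_rep g (A : set (borel B)) : measurable A ->
  \int[nu]_(b in A) (weight (coset_rep g) b)%:E =
  \int[nu]_(b in A) (weight g b)%:E.
Proof.
move=> mA; rewrite -{1}(mulVKg g (coset_rep g)).
by apply: integral_weight_mulr => //; exact: coset_repP.
Qed.

(** The sum of the weights over the cosets has the same integral over [A] as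
    its translates by [K], since translation permutes the cosets. Averaging
    over [K] replaces it by its mean value on [B], and each weight has
    integral 1. *)
Lemma sum_weight_cosets (A : set (borel B)) : measurable A ->
  \sum_(g \in D) \int[nu]_(b in A) (weight g b)%:E =
  (#|` fset_set D|%:R)%:E * nu A.
Proof.
move=> mA; have mw g := measurable_EFin_normalized_weight c_cocycle g.
have w0 g b : 0 <= (weight g b)%:E.
  by rewrite lee_fin (normalized_weight_ge0 act_measurable c_cocycle).
pose f (b : borel B) := \sum_(g \in D) (weight g b)%:E.
have mf : measurable_fun setT f by exact: emeasurable_fsum.
have f0 b : 0 <= f b by apply: fsume_ge0 => *; exact: w0.
have int_f_act k : K k -> \int[nu]_(b in A) f (act k^-1%g b) =
    \sum_(g \in D) \int[nu]_(b in A) (weight g b)%:E.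
  move=> Kk; rewrite /f ge0_integral_fsum//; last first.
    move=> g; apply: measurable_funTS.
    exact: (measurable_comp_act act_measurable k^-1%g (mw g)).
  rewrite [RHS](reindex_fsbig (fun g => coset_rep (k * g)%g) D D _
    (coset_rep_mull_bij Kk)).
  apply: eq_fsbigr => g _.
  rewrite (integral_weight_coset_rep _ mA).
  exact/esym/integral_weight_mull.
have int_f : \int[nu]_b f b = (#|` fset_set D|%:R)%:E.
  rewrite /f ge0_integral_fsum//.
  under eq_fsbigr do rewrite (integral_normalized_weight act_measurable c_cocycle).
  rewrite fsbig_finite//= big_const_seq count_predT.
  by elim: size => //= n ->; rewrite -nat1r EFinD.
have := @integral_transitive_average R G mu mu_haar K KV KM K_open K_fin B nu act
  act_action act_measurable K_transitive K_invariant f mf f0 A mA.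
rewrite int_f -muleA muleC.
rewrite (eq_integral (cst (\sum_(g \in D) \int[nu]_(b in A) (weight g b)%:E)));
  last first.
  by move=> k /set_mem /int_f_act.
rewrite (integral_cst mu (measurable_open_subgroup K_open)) => /esym.
rewrite [nu A * _]muleC.
have Kfin : mu K \is a fin_num by rewrite ge0_fin_numE.
by move/(inc_inj (lee_pmul2r Kfin K_gt0)).
Qed.

End OpenCosets.

(** * The Schur test *)

(** Cauchy-Schwarz with weights. The induction step reduces to the
    nonnegativity of a quadratic polynomial whose discriminant is controlled
    by the induction hypothesis. *)
Lemma sqr_weighted_sum_le (R : realFieldType) (I : Type) (s : seq I) (a x : I -> R) :
  (forall i, 0 <= a i) ->
  (\sum_(i <- s) a i * x i) ^+ 2 <=
  (\sum_(i <- s) a i) * \sum_(i <- s) a i * x i ^+ 2.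
Proof.
move=> a0; elim: s => [|i s IH]; first by rewrite !big_nil expr0n mul0r.
rewrite !big_cons.
have P0 : 0 <= \sum_(i <- s) a i by exact: sumr_ge0.
have R0 : 0 <= \sum_(i <- s) a i * x i ^+ 2.
  by apply: sumr_ge0 => j _; rewrite mulr_ge0// sqr_ge0.
move: (a0 i) IH P0 R0; move: (a i) (x i) (\sum_(i <- s) a i).
move: (\sum_(i <- s) a i * x i ^+ 2) (\sum_(i <- s) a i * x i) => W Q t y P.
move=> t0 QPW P0 W0.
(* the cross term of (Q + t y)^2 <= (P + t) (W + t y^2) *)
suff h : 2 * Q * y <= P * y ^+ 2 + W by have := ler_wpM2l t0 h; nra.
move: P0; rewrite le_eqVlt => /predU1P[PE|P_gt0].
  have -> : Q = 0 by apply/eqP; rewrite -sqrf_eq0 eq_le sqr_ge0 andbT; nra.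
  by rewrite -PE; nra.
(* after multiplication by P: (P y - Q)^2 + (P W - Q^2) >= 0 *)
rewrite -(ler_pM2l P_gt0).
by have := sqr_ge0 (P * y - Q); nra.
Qed.

Section IntegralBounds.
Local Open Scope ereal_scope.
Context d (T : measurableType d) (R : realType).

(** The integral of a nonnegative function is a supremum over the simple
    functions below it, so monotonicity holds for every [f], measurable or
    not; this is applied to the image of a function of L^2. *)
Lemma le_integral_majorant (mu : {measure set T -> \bar R}) (f g : T -> \bar R) :
  (forall x, 0 <= f x) -> (forall x, f x <= g x) ->
  \int[mu]_x f x <= \int[mu]_x g x.
Proof.
move=> f0 fg; have g0 x : 0 <= g x by exact: le_trans (f0 x) (fg x).
rewrite !ge0_integralTE//; apply: le_ereal_sup => _ [h hf <-].
by exists h => // x; exact: le_trans (hf x) (fg x).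
Qed.

(** Testing on the set [A] where [h] exceeds [M] shows that the nonnegative
    function [h - M] has integral zero on [A]. *)
Lemma ae_le_of_integrals (mu : {finite_measure set T -> \bar R}) (h : T -> R) (M : R) :
  measurable_fun setT h -> (0 <= M)%R ->
  (forall A, measurable A -> \int[mu]_(x in A) (h x)%:E <= M%:E * mu A) ->
  {ae mu, forall x, (h x <= M)%R}.
Proof.
move=> mh M0 hM.
pose A := [set x | (M < h x)%R].
have mA : measurable A.
  rewrite -[X in measurable X]setTI.
  exact: (measurable_fun_ltr (measurable_cst M) mh measurableT (Y := [set true])).
have mhM : measurable_fun A (fun x => (h x - M)%:E).
  by apply/measurable_funTS/measurable_EFinP; exact: measurable_funB.
have hM0 x : A x -> 0 <= (h x - M)%:E by move=> /ltW; rewrite lee_fin subr_ge0.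
have int0 : \int[mu]_(x in A) (h x - M)%:E = 0.
  apply/eqP; rewrite eq_le integral_ge0// andbT.
  have := hM A mA.
  have -> : \int[mu]_(x in A) (h x)%:E =
      \int[mu]_(x in A) ((h x - M)%:E + (cst M x)%:E).
    by apply: eq_integral => x _; rewrite -EFinD subrK.
  rewrite ge0_integralD//; last exact/measurable_EFinP.
  rewrite (integral_cst mu mA M%:E) -[X in _ <= X]add0e leeD2rE//.
  by rewrite fin_numM// fin_num_measure.
have : ae_eq mu A (fun x => (h x - M)%:E) (cst 0).
  apply/ae_eq_integral_abs => //; rewrite -int0.
  by apply: eq_integral => x /set_mem/hM0 /gee0_abs.
apply: filterS => x /= hx; rewrite leNgt; apply/negP => Mhx.
by move: (hx Mhx) => [] /eqP; rewrite subr_eq0 => /eqP E; move: Mhx; rewrite E ltxx.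
Qed.
End IntegralBounds.

Section SchurTest.
Local Open Scope ereal_scope.
Variables (R : realType) (G : topologicalGroupType) (B : ptopologicalType).
Variables (nu : probability (borel B) R) (act : G -> B -> B) (c : G -> B -> R).
Hypothesis act_action : is_action act.
Hypothesis act_measurable : measurable_action act.
Hypothesis c_cocycle : radon_nikodym_cocycle act nu c.

Local Notation weight := (normalized_weight nu c).

Lemma normalized_weight_duality g (f : borel B -> \bar R) :
  measurable_fun setT f -> (forall b, 0 <= f b) ->
  \int[nu]_b ((weight g b)%:E * f (act g^-1%g b)) =
  \int[nu]_b ((weight g^-1%g b)%:E * f b).
Proof.
move=> mf f0.
have Xi0 : 0 <= (harish_chandra nu c g)^-1%:E.
  by rewrite lee_fin invr_ge0 ltW// (harish_chandra_gt0 act_measurable c_cocycle).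
have mw h : measurable_fun setT (fun b : borel B => (koopman_weight c h b)%:E).
  exact: measurable_EFin_koopman_weight c_cocycle h.
have mfg := measurable_comp_act act_measurable g^-1%g mf.
transitivity (\int[nu]_b ((harish_chandra nu c g)^-1%:E *
    ((koopman_weight c g b)%:E * f (act g^-1%g b)))).
  by apply: eq_integral => b _; rewrite /normalized_weight mulrC EFinM -muleA.
rewrite ge0_integralZl//; last 2 first.
- exact: emeasurable_funM.
- by move=> b _; rewrite mule_ge0// lee_fin (koopman_weight_ge0 c_cocycle).
rewrite (koopman_weight_duality act_action act_measurable c_cocycle)//.
rewrite -ge0_integralZl//; last 2 first.
- exact: emeasurable_funM.
- by move=> b _; rewrite mule_ge0// lee_fin (koopman_weight_ge0 c_cocycle).
apply: eq_integral => b _; rewrite /normalized_weight mulrC EFinM -muleA.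
by rewrite (harish_chandraV act_action act_measurable c_cocycle).
Qed.

(** Cauchy-Schwarz with weights bounds the square by the product of the sum of
    the weights, at most [M], and of the same operator applied to [k ^ 2]. By
    duality and the symmetry of [s], the integral of the latter is that of
    [k ^ 2] against the sum of the weights, which gives the second factor [M]. *)
Lemma schur_test (s : seq G) (M : R) (k : borel B -> R) :
  perm_eq (map (fun g => g^-1%g) s) s -> (0 <= M)%R ->
  {ae nu, forall b : borel B, (\sum_(g <- s) weight g b <= M)%R} ->
  measurable_fun setT k ->
  \int[nu]_b ((\sum_(g <- s) weight g b * k (act g^-1%g b)) ^+ 2)%:E <=
  (M ^+ 2)%:E * \int[nu]_b (k b ^+ 2)%:E.
Proof.
move=> sV M0 sM mk.
have w0 g b : (0 <= weight g b)%R := normalized_weight_ge0 act_measurable c_cocycle g b.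
have mw g := measurable_EFin_normalized_weight c_cocycle g.
have mk2 : measurable_fun setT (fun b : borel B => (k b ^+ 2)%:E).
  by apply/measurable_EFinP; exact: measurable_funX.
have k20 b : 0 <= (k b ^+ 2)%:E by rewrite lee_fin sqr_ge0.
have mk2g g := measurable_comp_act act_measurable g^-1%g mk2.
have mwk g : measurable_fun setT (fun b : borel B =>
    (weight g b)%:E * (k (act g^-1%g b) ^+ 2)%:E) by exact: emeasurable_funM.
pose u (b : borel B) := \sum_(g <- s) (weight g b)%:E.
have mfu : measurable_fun setT u by exact: emeasurable_sum.
pose V (b : borel B) := \sum_(g <- s) ((weight g b)%:E * (k (act g^-1%g b) ^+ 2)%:E).
have mV : measurable_fun setT V by exact: emeasurable_sum.
have V0 b : 0 <= V b by apply: sume_ge0 => g _; rewrite mule_ge0// lee_fin.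
have u0 b : 0 <= u b by apply: sume_ge0 => g _; rewrite lee_fin.
have uM : {ae nu, forall b, setT b -> u b <= M%:E}.
  by apply: filterS sM => b + _; rewrite /u sumEFin lee_fin.
have int_V : \int[nu]_b V b = \int[nu]_b (u b * (k b ^+ 2)%:E).
  rewrite /V ge0_integral_sum//; last first.
    by move=> g b _; rewrite mule_ge0// lee_fin.
  rewrite (eq_bigr (fun g => \int[nu]_b ((weight g^-1%g b)%:E * (k b ^+ 2)%:E)));
    last first.
    by move=> g _; rewrite (@normalized_weight_duality g (fun b => (k b ^+ 2)%:E)).
  rewrite -(big_map (fun g => g^-1%g) xpredT
    (fun g => \int[nu]_b ((weight g b)%:E * (k b ^+ 2)%:E))) (perm_big _ sV)/=.
  rewrite -ge0_integral_sum//; last 2 first.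
  - by move=> g; exact: emeasurable_funM.
  - by move=> g b _; rewrite mule_ge0// lee_fin.
  by apply: eq_integral => b _; rewrite ge0_sume_distrl// => g _; rewrite lee_fin.
apply: (@le_trans _ _ (\int[nu]_b (u b * V b))).
  apply: le_integral_majorant => b; first by rewrite lee_fin sqr_ge0.
  rewrite /u /V; under [X in _ <= _ * X]eq_bigr do rewrite -EFinM.
  by rewrite !sumEFin -EFinM lee_fin; exact: sqr_weighted_sum_le.
apply: (@le_trans _ _ (\int[nu]_b (M%:E * V b))).
  apply: ae_ge0_le_integral => //.
  - by move=> b _; rewrite mule_ge0.
  - exact: emeasurable_funM.
  - by move=> b _; rewrite mule_ge0// lee_fin.
  - exact: emeasurable_funM.
  - by apply: filterS uM => b /(_ I) ub _; rewrite lee_wpmul2r.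
rewrite ge0_integralZl// int_V expr2 EFinM -muleA.
apply: lee_wpmul2l; first by rewrite lee_fin.
rewrite -ge0_integralZl//; apply: ae_ge0_le_integral => //.
- by move=> b _; rewrite mule_ge0.
- exact: emeasurable_funM.
- by move=> b _; rewrite mule_ge0// lee_fin.
- exact: emeasurable_funM.
- by apply: filterS uM => b /(_ I) ub _; rewrite lee_wpmul2r.
Qed.

End SchurTest.

(** * Operator norms of weighted means *)

Local Notation normc := ComplexField.Normc.normc.

Section ComplexNorm.
Variable R : realType.

Lemma normc_ge0 (z : R[i]) : 0 <= normc z.
Proof. by case: z => a b; exact: sqrtr_ge0. Qed.

Lemma normc_real (x : R) : 0 <= x -> normc x%:C%C = x.
Proof. by move=> x0; rewrite /= expr0n /= addr0 sqrtr_sqr ger0_norm. Qed.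

Lemma normc_sum (I : Type) (s : seq I) (f : I -> R[i]) :
  normc (\sum_(i <- s) f i) <= \sum_(i <- s) normc (f i).
Proof.
elim: s => [|i s IH]; first by rewrite !big_nil ComplexField.Normc.normc0.
rewrite !big_cons; apply: le_trans (le_normcD _ _) _.
by rewrite lerD2l.
Qed.

Variables (B : ptopologicalType) (nu : probability (borel B) R).
Implicit Types h : B -> R[i].

Lemma measurable_normc h :
  measurable_fun [set: borel B] (fun b : borel B => complex.Re (h b)) ->
  measurable_fun [set: borel B] (fun b : borel B => complex.Im (h b)) ->
  measurable_fun [set: borel B] (fun b : borel B => normc (h b)).
Proof.
move=> mRe mIm.
rewrite (_ : (fun b : borel B => normc (h b)) = (fun b : borel B =>
  Num.sqrt (complex.Re (h b) ^+ 2 + complex.Im (h b) ^+ 2))); last first.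
  by apply/funext => b; case: (h b).
apply: (@measurableT_comp _ _ _ _ _ _ (@Num.sqrt R)).
  exact: continuous_measurable_fun (@sqrt_continuous R).
by apply: measurable_funD; exact: measurable_funX.
Qed.

Lemma norm2_sqrE h :
  (norm2 nu h `^ 2 = \int[nu]_b (normc (h b) ^+ 2)%:E)%E.
Proof.
rewrite /norm2 poweR_Lnorm ?pnatr_eq0//; apply: eq_integral => b _.
by rewrite gee0_abs ?lee_fin ?normc_ge0// poweR_EFin powR_mulrn ?normc_ge0.
Qed.

Lemma norm2_ge0 h : (0 <= norm2 nu h)%E.
Proof. exact: Lnorm_ge0. Qed.

(** Reduces estimates of the operator norm to integrals of squares, in the
    extended reals because the integral may be infinite. *)
Lemma norm2_le h (M : R) : 0 <= M ->
  (norm2 nu h <= M%:E)%E <->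
  (\int[nu]_b (normc (h b) ^+ 2)%:E <= (M ^+ 2)%:E)%E.
Proof.
move=> M0; rewrite -norm2_sqrE -powR_mulrn// -poweR_EFin.
have n0 := norm2_ge0 h; move: (norm2 nu h) n0 => x x0.
have inI (y : \bar R) : (0 <= y)%E -> y \in `[0%E, +oo%E].
  by move=> y0; rewrite in_itv /= y0 leey.
split=> [xM|].
  by apply: gt0_ler_poweR => //; rewrite inI ?lee_fin.
move=> /(gt0_ler_poweR (r := 2^-1) _) -/(_ _ _).
rewrite -!poweRrM mulfV ?pnatr_eq0// !poweRe1 ?lee_fin//; apply.
- by rewrite invr_ge0.
- by rewrite inI// poweR_ge0.
- by rewrite inI// poweR_ge0.
Qed.

End ComplexNorm.

Section WeightedMean.
Variables (R : realType) (G : topologicalGroupType) (B : ptopologicalType).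
Variables (nu : probability (borel B) R) (act : G -> B -> B) (c : G -> B -> R).
Hypothesis act_action : is_action act.
Hypothesis act_measurable : measurable_action act.
Hypothesis c_cocycle : radon_nikodym_cocycle act nu c.

Local Notation weight := (normalized_weight nu c).
Local Notation mean C :=
  (weighted_mean C (harish_chandra nu c) (koopman act c)).

Lemma normc_weighted_mean (C : set G) (h : B -> R[i]) (b : B) : finite_set C ->
  normc (mean C h b) <= (#|` fset_set C|%:R)^-1 *
    \sum_(g <- fset_set C) weight g b * normc (h (act g^-1%g b)).
Proof.
move=> fC; rewrite /weighted_mean ComplexField.Normc.normcM.
rewrite ComplexField.Normc.normcV -[X in normc X](rmorph_nat (real_complex R)).
rewrite normc_real// ler_wpM2l ?invr_ge0// fsbig_finite//.
apply: le_trans (normc_sum _ _) _; apply: ler_sum => g _.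
have Xi_gt0 := harish_chandra_gt0 act_measurable c_cocycle g.
rewrite /koopman !ComplexField.Normc.normcM ComplexField.Normc.normcV.
rewrite !normc_real ?sqrtr_ge0//; last exact: ltW.
by rewrite mulrAC.
Qed.

(** The modulus of the image of [h] is at most the image of the modulus of [h],
    so the Schur test for nonnegative functions suffices. The case of an
    empty [C] is included, as the inverse of 0 is 0. *)
Lemma opnorm22_weighted_mean (C : set G) (M : R) :
  finite_set C -> (forall g, C g -> C g^-1%g) -> 0 <= M ->
  {ae nu, forall b : borel B,
    \sum_(g <- fset_set C) weight g b <= M * #|` fset_set C|%:R} ->
  (opnorm22 nu (mean C) <= M%:E)%E.
Proof.
move=> fC CV M0 sM; apply: ge_ereal_sup => _ [h [[mRe mIm _] h1] <-].
have mk := measurable_normc mRe mIm.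
apply/norm2_le => //.
have /(norm2_le _ _ ler01) := h1; rewrite expr1n => k1.
have sV : perm_eq (map (fun g => g^-1%g) (fset_set C)) (fset_set C).
  apply: uniq_perm => [||g].
  - by rewrite map_inj_uniq ?fset_uniq//; exact: invg_inj.
  - exact: fset_uniq.
  rewrite in_fset_set//; apply/mapP/idP => [[x]|gC].
    by rewrite in_fset_set// inE => Cx ->; rewrite inE; exact: CV.
  exists g^-1%g; last by rewrite invgK.
  by rewrite in_fset_set// inE; apply: CV; rewrite inE in gC.
set n : R := #|` fset_set C|%:R in sM *.
have Mn0 : 0 <= M * n by rewrite mulr_ge0// ler0n.
have schur := schur_test act_action act_measurable c_cocycle sV Mn0 sM mk.
pose W (b : borel B) :=
  \sum_(g <- fset_set C) weight g b * normc (h (act g^-1%g b)).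
have mW2 : measurable_fun setT (fun b : borel B => ((W b) ^+ 2)%:E).
  apply/measurable_EFinP; apply: measurable_funX; apply: measurable_sum => g.
  apply: measurable_funM.
    by apply/measurable_EFinP; exact: measurable_EFin_normalized_weight c_cocycle g.
  exact: (measurable_comp_act act_measurable g^-1%g mk).
apply: (@le_trans _ _ (\int[nu]_b ((n^-1 ^+ 2)%:E * ((W b) ^+ 2)%:E))%E).
  apply: le_integral_majorant => b; first by rewrite lee_fin sqr_ge0.
  rewrite -EFinM -exprMn lee_fin ler_sqr ?nnegrE ?normc_ge0//.
    exact: normc_weighted_mean.
  exact: le_trans (normc_ge0 _) (normc_weighted_mean _ _ fC).
rewrite ge0_integralZl//; last 2 first.
- by move=> b _; rewrite lee_fin sqr_ge0.
- by rewrite lee_fin sqr_ge0.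
apply: (@le_trans _ _ ((n^-1 ^+ 2)%:E * ((M * n) ^+ 2)%:E)%E).
  apply: lee_wpmul2l; first by rewrite lee_fin sqr_ge0.
  apply: le_trans schur _; rewrite -[leRHS]mule1.
  by apply: lee_wpmul2l => //; rewrite lee_fin sqr_ge0.
rewrite -EFinM -exprMn lee_fin ler_sqr ?nnegrE//; last first.
  by rewrite mulr_ge0// invr_ge0 ler0n.
rewrite mulrCA ler_piMr//.
have [->|n0] := eqVneq n 0; first by rewrite mulr0.
by rewrite mulVf.
Qed.
End WeightedMean.

(** * Sums over a discrete subgroup *)

Section DiscreteSum.
Variables (R : realType) (G : topologicalGroupType).
Variable mu : {measure set (borel G) -> \bar R}.
Hypothesis mu_haar : left_haar mu.
Variable K : set G.
Hypothesis K1 : K 1%g.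
Hypothesis KV : forall k, K k -> K k^-1%g.
Hypothesis KM : forall k l, K k -> K l -> K (k * l)%g.
Hypothesis K_open : open K.
Hypothesis K_fin : (mu K < +oo)%E.
Hypothesis K_gt0 : (0 < mu K)%E.
Variable S : set G.
Hypothesis S_mull : forall k g, K k -> S g -> S (k * g)%g.
Hypothesis S_mulr : forall g k, S g -> K k -> S (g * k)%g.
Hypothesis S_finite : finite_set (coset_rep K @` S).
Variables (B : ptopologicalType) (nu : probability (borel B) R).
Variables (act : G -> B -> B) (c : G -> B -> R).
Hypothesis act_action : is_action act.
Hypothesis act_measurable : measurable_action act.
Hypothesis c_cocycle : radon_nikodym_cocycle act nu c.
Hypothesis K_transitive : transitive_on act K.
Hypothesis K_invariant : invariant_under act nu K.
Variable Lambda : groupClosed G.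
Hypothesis LambdaK_finite : finite_set [set g | g \in Lambda /\ K g].
Variable C : set G.
Hypothesis C_finite : finite_set C.
Hypothesis C_sub : forall g, C g -> g \in Lambda /\ S g.

Local Notation weight := (normalized_weight nu c).
Local Notation stab := (fset_set [set g | g \in Lambda /\ K g]).
Local Notation cosets := (fset_set (coset_rep K @` S)).

(** Lattice points of a common coset differ by elements of [Lambda] and [K]. *)
Lemma count_coset_le (x : G) :
  (count (fun g => coset_rep K g == x) (fset_set C) <= #|` stab|)%N.
Proof.
rewrite -size_filter; set s := [seq g <- fset_set C | coset_rep K g == x].
have sP g : g \in s -> C g /\ coset_rep K g = x.
  by rewrite mem_filter => /andP[/eqP gx]; rewrite in_fset_set// inE.
have us : uniq s by rewrite filter_uniq// fset_uniq.
case: s sP us => // g0 s sP us.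
have [/C_sub[L0 _] g0x] := sP g0 (mem_head _ _).
rewrite -(size_map (fun g => g0^-1 * g)%g); apply: uniq_leq_size.
  by rewrite map_inj_uniq//; exact: mulgI.
move=> _ /mapP[g gs ->].
have [/C_sub[Lg _] gx] := sP g gs.
rewrite in_fset_set// inE; split; first by rewrite gpredM// gpredV.
by apply: (coset_rep_inj K1 KV KM); rewrite g0x gx.
Qed.

Lemma discrete_sum_ae :
  {ae nu, forall b : borel B, \sum_(g <- fset_set C) weight g b <=
    #|` stab|%:R * #|` cosets|%:R}.
Proof.
have mw g := measurable_EFin_normalized_weight c_cocycle g.
have w0 g b := normalized_weight_ge0 act_measurable c_cocycle g b.
apply: ae_le_of_integrals.
- by apply: measurable_sum => g; apply/measurable_EFinP; exact: mw.
- by rewrite mulr_ge0.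
move=> A mA; under eq_integral do rewrite -sumEFin.
rewrite ge0_integral_sum//; last 2 first.
- by move=> g; exact: measurable_funTS.
- by move=> g b _; rewrite lee_fin.
have repE g := @integral_weight_coset_rep R G K K1 KV B nu act c act_action
  act_measurable c_cocycle K_invariant g A mA.
under eq_bigr do rewrite -repE.
have := @sum_fibers_le R G G (fset_set C) cosets (coset_rep K)
  (fun g => \int[nu]_(b in A) (weight g b)%:E)%E #|` stab|.
have := @sum_weight_cosets R G mu mu_haar K K1 KV KM K_open S S_mull S_mulr
  S_finite B nu act c act_action act_measurable c_cocycle K_transitive
  K_invariant K_fin K_gt0 A mA.
rewrite fsbig_finite// => -> sum_le; rewrite EFinM -muleA; apply: sum_le.
- exact: fset_uniq.
- move=> g; rewrite in_fset_set// inE => /C_sub[_ Sg].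
  by rewrite in_fset_set// inE; exists g.
- by move=> g; apply: integral_ge0 => b _; rewrite lee_fin.
- by move=> g _; exact: count_coset_le.
Qed.

End DiscreteSum.

(** * Shells of a length function *)

Section LengthShells.
Variables (R : realType) (G : topologicalGroupType) (ell : G -> R).
Hypothesis ell_length : length_function ell.

Lemma length_zero1 : length_zero ell 1%g.
Proof. by case: ell_length. Qed.

Lemma length_zeroV k : length_zero ell k -> length_zero ell k^-1%g.
Proof. by case: ell_length => _ _ ellV _; rewrite /length_zero /= ellV. Qed.

(** Subadditivity applied to [k g] and to [k^-1 (k g)]. *)
Lemma length_zero_mull k g : length_zero ell k -> ell (k * g)%g = ell g.
Proof.
move=> k0; have := length_zeroV k0; move: k0; case: ell_length => _ _ _ ellM.
rewrite /length_zero /= => k0 kV0; apply/eqP; rewrite eq_le; apply/andP; split.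
  by have := ellM k g; rewrite k0 add0r.
by have := ellM k^-1%g (k * g)%g; rewrite kV0 add0r mulKg.
Qed.

Lemma length_zero_mulr g k : length_zero ell k -> ell (g * k)%g = ell g.
Proof.
move=> k0; have [_ _ ellV _] := ell_length.
rewrite -ellV invgM length_zero_mull ?ellV//; exact: length_zeroV.
Qed.

Lemma length_zeroM k l :
  length_zero ell k -> length_zero ell l -> length_zero ell (k * l)%g.
Proof. by move=> k0 l0; rewrite /length_zero /= length_zero_mull. Qed.

Lemma shell_mull (n : nat) k g : length_zero ell k ->
  shell ell setT n g -> shell ell setT n (k * g)%g.
Proof. by move=> k0 [_ gn]; split => //; rewrite length_zero_mull. Qed.

Lemma shell_mulr (n : nat) g k :
  shell ell setT n g -> length_zero ell k -> shell ell setT n (g * k)%g.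
Proof. by move=> [_ gn] k0; split => //; rewrite length_zero_mulr. Qed.

Hypothesis ell_proper : proper_length ell.

Lemma compact_length_zero : compact (length_zero ell).
Proof.
rewrite (_ : length_zero ell = [set g | ell g <= 0]); first exact: ell_proper.
have [ell0 _ _ _] := ell_length.
apply/seteqP; split => g /=; first by move=> ->.
by move=> g0; apply/eqP; rewrite eq_le g0 ell0.
Qed.

Lemma finite_shell_cosets (n : nat) : open (length_zero ell) ->
  finite_set (coset_rep (length_zero ell) @` shell ell setT n).
Proof.
move=> G0_open; apply: sub_finite_set (finite_coset_rep length_zero1 length_zeroV
  length_zeroM G0_open (ell_proper (ler0n R n.+1))).
by apply: image_subset => g [_ /andP[_ /ltW]].
Qed.

End LengthShells.

(** For an infinite set the mean is the zero operator, as [fset_set C] is empty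
    and the inverse of 0 is 0. *)
Lemma opnorm22_infinite_mean (R : realType) (G : topologicalGroupType)
    (B : ptopologicalType) (nu : probability (borel B) R) (C : set G)
    (w : G -> R) (T : G -> (B -> R[i]) -> B -> R[i]) (M : R) :
  infinite_set C -> 0 <= M -> (opnorm22 nu (weighted_mean C w T) <= M%:E)%E.
Proof.
move=> Coo M0; apply: ge_ereal_sup => _ [h _ <-]; apply/norm2_le => //.
have C0 : fset_set C = fset0 by rewrite /fset_set; case: pselect.
rewrite integral0_eq ?lee_fin ?sqr_ge0// => b _.
rewrite /weighted_mean C0 cardfs0 invr0 mul0r.
by rewrite ComplexField.Normc.normc0 expr0n.
Qed.

Theorem theorem2 (R : realType)
    (G : topologicalGroupType) (mu : {measure set (borel G) -> \bar R})
    (ell : G -> R)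
    (B : ptopologicalType) (nu : probability (borel B) R)
    (act : G -> B -> B) (c : G -> B -> R)
    (Lambda : groupClosed G)
    (G_hausdorff : hausdorff_space G)
    (G_locally_compact : locally_compact [set: G])
    (mu_haar : left_haar mu)
    (ell_length : length_function ell)
    (ell_proper : proper_length ell)
    (B_compact : compact [set: B])
    (act_action : is_action act)
    (act_measurable : measurable_action act)
    (nu_quasi_invariant : quasi_invariant act nu)
    (c_cocycle : radon_nikodym_cocycle act nu c)
    (c_continuous : continuous (fun x : G * B => c x.1 x.2))
    (Xi_continuous : continuous (harish_chandra nu c))
    (G0_open : open (length_zero ell))
    (G0_transitive : transitive_on act (length_zero ell))
    (G0_invariant : invariant_under act nu (length_zero ell))
    (Lambda_lattice : lattice R Lambda)
    (shell_growth : exists k : R, \forall n \near \oo,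
      (mu (shell ell [set: G] n) <=
       (k * #|` fset_set (shell ell [set g | g \in Lambda] n)|%:R)%:E)%E) :
  exists M : R, forall n : nat,
    shell ell [set g | g \in Lambda] n !=set0 ->
    (opnorm22 nu
       (weighted_mean (shell ell [set g | g \in Lambda] n)
          (harish_chandra nu c) (koopman act c)) <= M%:E)%E.
Proof.
have G0_1 := length_zero1 ell_length.
have G0_V := length_zeroV ell_length.
have G0_M := length_zeroM ell_length.
have G0_fin : (mu (length_zero ell) < +oo)%E.
  by case: mu_haar => -[fin_compact _ _] _ _; exact/fin_compact/compact_length_zero.
have G0_gt0 : (0 < mu (length_zero ell))%E.
  exact: (haar_open_subgroup_gt0 mu_haar G0_1 G0_V G0_M G0_open G_hausdorff).
have S_fin n := finite_shell_cosets ell_length ell_proper n G0_open.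
pose D n := #|` fset_set (coset_rep (length_zero ell) @` shell ell setT n)|.
have muS n : mu (shell ell setT n) = ((D n)%:R%:E * mu (length_zero ell))%E.
  apply: (haar_invariant_set mu_haar) => //.
  by move=> g k; exact: shell_mulr.
pose r := fine (mu (length_zero ell)).
have muE : mu (length_zero ell) = r%:E by rewrite fineK// ge0_fin_numE.
have r_gt0 : 0 < r by rewrite -lte_fin -muE.
have [k [N _ growth]] := shell_growth.
pose stab := #|` fset_set [set g | g \in Lambda /\ length_zero ell g]|.
pose M := `|k| / r + \sum_(i < N) (D i)%:R.
have sum0 : 0 <= \sum_(i < N) (D i)%:R :> R by exact: sumr_ge0.
have kr0 : 0 <= `|k| / r by rewrite divr_ge0// ltW.
have M0 : 0 <= M by rewrite addr_ge0.
(* [`|k| / r] bounds the number of cosets per lattice point in the shells to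
   which the growth hypothesis applies; the sum bounds the number of cosets
   in each of the first [N] shells, for which one lattice point suffices *)
exists (stab%:R * M) => n [g0 g0C].
set C := shell ell _ n.
have [C_fin|C_inf] := pselect (finite_set C); last first.
  by apply: opnorm22_infinite_mean => //; rewrite mulr_ge0.
(* [g0] translates [Lambda :&: K] into the finite set [C] *)
have stab_fin : finite_set [set g | g \in Lambda /\ length_zero ell g].
  apply: sub_finite_set (finite_image (fun g => g0^-1 * g)%g C_fin).
  move=> g [gL g_0]; exists (g0 * g)%g; last by rewrite mulKg.
  case: g0C => g0L g0n; split; first exact: gpredM.
  by rewrite length_zero_mulr.
have D_le : (D n)%:R <= M * #|` fset_set C|%:R.
  have C_gt0 : 1 <= #|` fset_set C|%:R :> R.
    rewrite ler1n cardfs_gt0; apply/fset0Pn; exists g0.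
    by rewrite in_fset_set// inE.
  rewrite mulrDl; have [nN|Nn] := ltnP n N.
    apply: (@le_trans _ _ (\sum_(i < N) (D i)%:R)).
      by rewrite (bigD1 (Ordinal nN))//= lerDl sumr_ge0.
    apply: ler_wpDl; first by rewrite mulr_ge0.
    by rewrite ler_peMr.
  apply: ler_wpDr; first by rewrite mulr_ge0.
  rewrite mulrAC ler_pdivlMr//.
  have := growth n Nn; rewrite muS muE -EFinM lee_fin => /le_trans; apply.
  by rewrite ler_wpM2r// ler_norm.
apply: (opnorm22_weighted_mean act_action act_measurable c_cocycle) => //.
- move=> g [gL gn]; split; first by rewrite /= gpredV.
  by case: ell_length => _ _ -> _.
- by rewrite mulr_ge0.
have := @discrete_sum_ae R G mu mu_haar (length_zero ell) G0_1 G0_V G0_M G0_open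
  G0_fin G0_gt0 (shell ell setT n) (shell_mull ell_length (n := n))
  (shell_mulr ell_length (n := n)) (S_fin n) B nu act c act_action act_measurable
  c_cocycle G0_transitive G0_invariant Lambda stab_fin C C_fin.
have C_sub g : C g -> g \in Lambda /\ shell ell setT n g by case.
move=> /(_ C_sub); apply: filterS => b /le_trans; apply.
by rewrite -mulrA ler_wpM2l.
Qed.
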